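(* Let $\mathcal{D}_n,\mathcal{D}\subset Y\times Y$ be closed nonempty sets and define on $V=L_p(\Omega;Y)\times L_q(\Omega;Y)$ the functionals $J(v)=\int_\Omega\operatorname{dist}(v(x),\mathcal{D})\,dx$ and $J_n(v)=\int_\Omega\operatorname{dist}(v(x),\mathcal{D}_n)\,dx$. The following are equivalent: (i) $\mathcal{D}_n\to\mathcal{D}$ in the bounded sense defined in the context; (ii) $\lim_{n\to\infty}J_n(v)=J(v)$ for all $v\in V$, and this convergence is uniform on bounded subsets of $V$.
   Context: $1<p<\infty$, $q=p/(p-1)$, $\Omega\subset\mathbb{R}^d$ bounded open set, $Y=\{A\in\mathbb{R}^{d\times d}:A=A^T,\operatorname{tr}A=0\}$ with Frobenius norm. For $z_i=(\epsilon_i,\tilde\sigma_i)$, $\operatorname{dist}(z_1,z_2)=\frac1p|\epsilon_1-\epsilon_2|^p+\frac1q|\tilde\sigma_1-\tilde\sigma_2|^q$, $\operatorname{dist}(z,\mathcal{D})=\inf_{w\in\mathcal{D}}\operatorname{dist}(z,w)$. Bounded data convergence $\mathcal{D}_n\to\mathcal{D}$: there are $a_n\to0$ with $\operatorname{dist}(z,\mathcal{D}_n)\le a_n(1+|\epsilon|^p+|\tilde\sigma|^q)$ for all $z=(\epsilon,\tilde\sigma)\in\mathcal{D}$, and $b_n\to0$ with $\operatorname{dist}(z_n,\mathcal{D})\le b_n(1+|\epsilon_n|^p+|\tilde\sigma_n|^q)$ for all $z_n=(\epsilon_n,\tilde\sigma_n)\in\mathcal{D}_n$. *)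

(* Defs.v *)
From HB Require Import structures.
From mathcomp Require Import all_boot all_order all_algebra.
From mathcomp Require Import all_classical all_reals all_analysis.

Set Implicit Arguments.
Unset Strict Implicit.
Unset Printing Implicit Defensive.

Import Order.TTheory GRing.Theory Num.Theory numFieldNormedType.Exports.

Local Open Scope classical_set_scope.
Local Open Scope ring_scope.

(** * The ambient space R^d, modelled as d.-tuple R
    (with its product = Borel sigma-algebra from mathcomp-analysis). *)

Definition tcons (R : realType) (n : nat) (x : R * n.-tuple R) : n.+1.-tuple R :=
  cons_tuple x.1 x.2.

Fixpoint lebesgue_tuple (R : realType) (n : nat) : set (n.-tuple R) -> \bar R :=
  match n return set (n.-tuple R) -> \bar R with
  | 0 => fun A => (\1_A [tuple] : R)%:E
  | n'.+1 => fun A =>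
      (((@lebesgue_measure R) \x (@lebesgue_tuple R n')) (@tcons R n' @^-1` A))%E
  end.

(** Open and bounded subsets of R^d (for the max-norm, equivalently the
    Euclidean norm). *)
Definition tuple_open (R : realType) (n : nat) (O : set (n.-tuple R)) : Prop :=
  forall x, O x -> exists2 e : R, 0 < e &
    forall y : n.-tuple R, (forall i, `|tnth y i - tnth x i| < e) -> O y.

Definition tuple_bounded (R : realType) (n : nat) (O : set (n.-tuple R)) : Prop :=
  exists M : R, forall x, O x -> forall i, `|tnth x i| <= M.

Definition inY (R : realType) (d : nat) (A : 'M[R]_d) : Prop :=
  A^T = A /\ \tr A = 0.

Definition frob (R : realType) (d : nat) (A : 'M[R]_d) : R :=
  Num.sqrt (\sum_(i < d) \sum_(j < d) A i j ^+ 2).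

Definition distz (R : realType) (d : nat) (p q : R) (z1 z2 : 'M[R]_d * 'M[R]_d) : R :=
  (frob (z1.1 - z2.1)) `^ p / p + (frob (z1.2 - z2.2)) `^ q / q.

Definition distD (R : realType) (d : nat) (p q : R) (z : 'M[R]_d * 'M[R]_d)
    (D : set ('M[R]_d * 'M[R]_d)) : R :=
  inf [set distz p q z w | w in D].

Definition bounded_data_conv (R : realType) (d : nat) (p q : R)
    (Dn : nat -> set ('M[R]_d * 'M[R]_d)) (D : set ('M[R]_d * 'M[R]_d)) : Prop :=
  (exists a : nat -> R, a @ \oo --> (0 : R) /\
     forall n z, D z ->
       distD p q z (Dn n) <= a n * (1 + frob z.1 `^ p + frob z.2 `^ q)) /\
  (exists b : nat -> R, b @ \oo --> (0 : R) /\
     forall n z, Dn n z ->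
       distD p q z D <= b n * (1 + frob z.1 `^ p + frob z.2 `^ q)).

Definition powint (R : realType) (d : nat) (Om : set (d.-tuple R)) (r : R)
    (f : d.-tuple R -> 'M[R]_d) : \bar R :=
  (\int[@lebesgue_tuple R d]_(x in Om) ((frob (f x)) `^ r)%:E)%E.

Definition inLr (R : realType) (d : nat) (Om : set (d.-tuple R)) (r : R)
    (f : d.-tuple R -> 'M[R]_d) : Prop :=
  [/\ forall x, Om x -> inY (f x),
      forall i j, measurable_fun Om (fun x => f x i j)
    & (powint Om r f < +oo)%E].

(** L_r norm (finite on L_r) *)
Definition Lr_norm (R : realType) (d : nat) (Om : set (d.-tuple R)) (r : R)
    (f : d.-tuple R -> 'M[R]_d) : R :=
  (fine (powint Om r f)) `^ (r^-1).

Definition inV (R : realType) (d : nat) (Om : set (d.-tuple R)) (p q : R)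
    (v : d.-tuple R -> 'M[R]_d * 'M[R]_d) : Prop :=
  inLr Om p (fun x => (v x).1) /\ inLr Om q (fun x => (v x).2).

Definition V_norm (R : realType) (d : nat) (Om : set (d.-tuple R)) (p q : R)
    (v : d.-tuple R -> 'M[R]_d * 'M[R]_d) : R :=
  Lr_norm Om p (fun x => (v x).1) + Lr_norm Om q (fun x => (v x).2).

Definition Jfun (R : realType) (d : nat) (Om : set (d.-tuple R)) (p q : R)
    (D : set ('M[R]_d * 'M[R]_d)) (v : d.-tuple R -> 'M[R]_d * 'M[R]_d) : \bar R :=
  (\int[@lebesgue_tuple R d]_(x in Om) (distD p q (v x) D)%:E)%E.

(* Main.v *)
(* Both conditions are equivalent to a third one: for every [e > 0] and all
   large [n], |dist(z, D_n) - dist(z, D)| <= e (1 + |eps|^p + |sigma|^q) for all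
   [z] in [Y * Y].  From bounded data convergence this follows by projecting [z]
   onto one set and the projection onto the other, using the quasi-triangle
   inequality dist(x, z) <= (1 + delta) dist(x, y) + C_delta dist(y, z).
   Integrating it over [Omega] gives uniform convergence on bounded sets.
   Conversely, it is obtained by testing uniform convergence on the bounded
   family of functions equal to [z] on a subset of [Omega] whose measure is
   inversely proportional to 1 + |eps|^p + |sigma|^q, and to a fixed point of
   [D] elsewhere. *)
Require Import Defs.
From HB Require Import structures.
From mathcomp Require Import all_boot all_order all_algebra.
From mathcomp Require Import all_classical all_reals all_analysis measurable_realfun.
From mathcomp Require Import ring lra.
Import Order.TTheory GRing.Theory Num.Theory numFieldNormedType.Exports.
Local Open Scope classical_set_scope.
Local Open Scope ring_scope.

Set Implicit Arguments.
Unset Strict Implicit.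
Unset Printing Implicit Defensive.

(** * The distance to a data set *)

(** By Lagrange's identity, the right side minus the left side is half the sum of the squares
    [(a i * b j - a j * b i) ^+ 2]. *)
Lemma cauchy_schwarz_sum (R : realType) (I : finType) (a b : I -> R) :
  (\sum_i a i * b i) ^+ 2 <= (\sum_i a i ^+ 2) * (\sum_i b i ^+ 2).
Proof.
rewrite expr2 !big_distrlr /=.
have -> : \sum_i \sum_j a i * b i * (a j * b j) =
  \sum_i \sum_j (a i ^+ 2 * b j ^+ 2 + a j ^+ 2 * b i ^+ 2) / 2
  - \sum_i \sum_j (a i * b j - a j * b i) ^+ 2 / 2.
  rewrite -sumrB; apply: eq_bigr => i _; rewrite -sumrB; apply: eq_bigr => j _.
  by field.
have -> : \sum_i \sum_j (a i ^+ 2 * b j ^+ 2 + a j ^+ 2 * b i ^+ 2) / 2 =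
  \sum_i \sum_j a i ^+ 2 * b j ^+ 2.
  transitivity (\sum_i \sum_j (a i ^+ 2 * b j ^+ 2 / 2) +
                \sum_i \sum_j (a j ^+ 2 * b i ^+ 2 / 2)).
    rewrite -big_split; apply: eq_bigr => i _; rewrite -big_split /=.
    by apply: eq_bigr => j _; rewrite mulrDl.
  rewrite [X in _ + X]exchange_big /= -big_split; apply: eq_bigr => i _.
  by rewrite -big_split; apply: eq_bigr => j _ /=; field.
rewrite gerBl; apply: sumr_ge0 => i _; apply: sumr_ge0 => j _.
by rewrite divr_ge0 // sqr_ge0.
Qed.

Lemma frobE (R : realType) (d : nat) (A : 'M[R]_d) :
  frob A = Num.sqrt (\sum_(k : 'I_d * 'I_d) A k.1 k.2 ^+ 2).
Proof. by rewrite /frob pair_bigA. Qed.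

Lemma frob_ge0 (R : realType) (d : nat) (A : 'M[R]_d) : 0 <= frob A.
Proof. exact: sqrtr_ge0. Qed.

Lemma frobN (R : realType) (d : nat) (A : 'M[R]_d) : frob (- A) = frob A.
Proof.
by rewrite !frobE; congr Num.sqrt; apply: eq_bigr => k _; rewrite mxE sqrrN.
Qed.

Lemma frob_triangle (R : realType) (d : nat) (A B : 'M[R]_d) :
  frob (A + B) <= frob A + frob B.
Proof.
rewrite -(ler_pXn2r (ltn0Sn 1)) ?nnegrE ?addr_ge0 ?frob_ge0 //.
have s2 (C : 'M[R]_d) : frob C ^+ 2 = \sum_(k : 'I_d * 'I_d) C k.1 k.2 ^+ 2.
  by rewrite frobE sqr_sqrtr // sumr_ge0 // => k _; rewrite sqr_ge0.
have cs : \sum_(k : 'I_d * 'I_d) A k.1 k.2 * B k.1 k.2 <= frob A * frob B.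
  apply: le_trans (ler_norm _) _.
  rewrite -(ler_pXn2r (ltn0Sn 1)) ?nnegrE ?mulr_ge0 ?frob_ge0 //.
  rewrite real_normK ?num_real // exprMn !s2; exact: cauchy_schwarz_sum.
rewrite sqrrD !s2.
rewrite (_ : \sum_k (A + B) k.1 k.2 ^+ 2 = \sum_k A k.1 k.2 ^+ 2 +
   (\sum_k A k.1 k.2 * B k.1 k.2) *+ 2 + \sum_k B k.1 k.2 ^+ 2); last first.
  rewrite -sumrMnl -!big_split; apply: eq_bigr => k _ /=.
  by rewrite mxE sqrrD.
by rewrite lerD2r lerD2l lerMn2r cs orbT.
Qed.

Lemma frob_entry_bound (R : realType) (d : nat) (A : 'M[R]_d) (e : R) :
  0 <= e -> (forall i j, `|A i j| <= e) -> frob A <= d%:R * e.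
Proof.
move=> e0 Ae; rewrite -[leRHS]ger0_norm ?mulr_ge0 // -sqrtr_sqr.
  rewrite /frob ler_wsqrtr // exprMn.
have -> : d%:R ^+ 2 * e ^+ 2 = \sum_(i < d) \sum_(j < d) e ^+ 2.
  by rewrite !sumr_const !card_ord -[in RHS]mulrnA -[in RHS]mulr_natl natrM expr2.
apply: ler_sum => i _; apply: ler_sum => j _.
by rewrite -(real_normK (num_real (A i j))) ler_pXn2r ?nnegrE ?Ae.
Qed.

(* Convexity of the power function applied to
   [a + b = u (a / u) + (1 - u) (b / (1 - u))] with [u ^ -r = 1 + delta]. *)
Lemma powR_add_le (R : realType) (r delta : R) : 1 <= r -> 0 < delta ->
  exists C : R, forall a b : R, 0 <= a -> 0 <= b ->
    (a + b) `^ r <= (1 + delta) * a `^ r + C * b `^ r.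
Proof.
move=> r1 delta0; have r0 : 0 < r by apply: lt_le_trans r1.
pose v := (1 + delta) `^ r^-1.
have v1 : 1 < v.
  have /(congr1 (@^~ r^-1)) /= e1 := @powR1 R.
  rewrite -[ltLHS]e1 gt0_ltr_powR ?nnegrE ?invr_gt0 ?ltrDl //.
  by rewrite addr_ge0 // ltW.
have vr : v `^ r = 1 + delta.
  by rewrite /v -powRrM mulVf ?gt_eqF // powRr1 // addr_ge0 // ltW.
have v0 : 0 < v by apply: lt_trans v1.
have u1 : v^-1 < 1 by rewrite invf_lt1.
have u0 : 0 < v^-1 by rewrite invr_gt0.
pose t := 1 - v^-1.
have t0 : 0 < t by rewrite subr_gt0.
have t1 : t <= 1 by rewrite lerBlDr lerDl ltW.
exists (t * t^-1 `^ r) => a b a0 b0.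
have : (t * (t^-1 * b) + (1 - t) * (v * a)) `^ r <=
    t * (t^-1 * b) `^ r + (1 - t) * (v * a) `^ r.
  by apply: (@convex_powR R r r1 (Itv01 (ltW t0) t1) (t^-1 * b) (v * a));
    rewrite inE /= in_itv /= andbT mulr_ge0 ?invr_ge0 ?(ltW t0) ?(ltW v0).
rewrite (_ : 1 - t = v^-1); last by rewrite /t; ring.
rewrite mulrA mulfV ?gt_eqF // mul1r mulrA mulVf ?gt_eqF // mul1r addrC.
move=> /le_trans -> //.
(* The term in [a] carries an extra factor [v^-1 < 1], which is dropped. *)
rewrite !powRM ?invr_ge0 ?(ltW t0) ?(ltW v0) // vr [leLHS]addrC mulrA [X in _ + X <= _]mulrA lerD2r.
by rewrite ler_wpM2r ?powR_ge0 // ler_piMl ?ltW // addr_gt0.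
Qed.

Lemma distz_ge0 (R : realType) (d : nat) (p q : R) (z w : 'M[R]_d * 'M[R]_d) :
  1 <= p -> 1 <= q -> 0 <= distz p q z w.
Proof.
by move=> p1 q1; rewrite addr_ge0 // divr_ge0 ?powR_ge0 // (le_trans _ p1, le_trans _ q1).
Qed.

Lemma distzC (R : realType) (d : nat) (p q : R) (z w : 'M[R]_d * 'M[R]_d) :
  distz p q z w = distz p q w z.
Proof. by rewrite /distz -[frob (z.1 - _)]frobN opprB -[frob (z.2 - _)]frobN opprB. Qed.

(* [dist ^ (1/r)] is a metric on each component; [dist] itself satisfies the
   triangle inequality up to constants, one of which can be taken close
   to [1]. *)
Lemma distz_triangle (R : realType) (d : nat) (p q delta : R) :
  1 <= p -> 1 <= q -> 0 < delta ->
  exists C : R, 0 <= C /\ forall x y z : 'M[R]_d * 'M[R]_d,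
    distz p q x z <= (1 + delta) * distz p q x y + C * distz p q y z.
Proof.
move=> p1 q1 d0.
have comp (r : R) : 1 <= r -> exists C : R, 0 <= C /\ forall A B E : 'M[R]_d,
    frob (A - E) `^ r / r <=
    (1 + delta) * (frob (A - B) `^ r / r) + C * (frob (B - E) `^ r / r).
  move=> r1; have [C HC] := powR_add_le r1 d0.
  have r0 : 0 <= r by apply: le_trans r1.
  exists (Num.max C 0); split; first by rewrite le_max lexx orbT.
  move=> A B E; rewrite !mulrA -mulrDl ler_wpM2r ?invr_ge0 //.
  have tri : frob (A - E) <= frob (A - B) + frob (B - E).
    by rewrite (_ : A - E = (A - B) + (B - E)) ?frob_triangle // subrKA.
  apply: le_trans (_ : (frob (A - B) + frob (B - E)) `^ r <= _).
    by rewrite ge0_ler_powR ?nnegrE ?addr_ge0 ?frob_ge0.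
  apply: le_trans (HC _ _ (frob_ge0 _) (frob_ge0 _)) _.
  by rewrite lerD2l ler_wpM2r ?powR_ge0 // le_max lexx.
have [C1 [C10 H1]] := comp p p1; have [C2 [C20 H2]] := comp q q1.
exists (C1 + C2); split; first exact: addr_ge0.
have ge (A : 'M[R]_d) (r : R) : 1 <= r -> 0 <= frob A `^ r / r.
  by move=> r1; rewrite divr_ge0 ?powR_ge0 // (le_trans _ r1).
(* The cross terms [C1 * c2] and [C2 * c1] are nonnegative, so the single constant [C1 + C2] serves
   both components. *)
have alg (a1 b1 c1 a2 b2 c2 : R) : 0 <= C1 * c2 -> 0 <= C2 * c1 ->
    a1 <= (1 + delta) * b1 + C1 * c1 -> a2 <= (1 + delta) * b2 + C2 * c2 ->
    a1 + a2 <= (1 + delta) * (b1 + b2) + (C1 + C2) * (c1 + c2).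
  by move=> *; lra.
move=> x y z; apply: alg (H1 _ _ _) (H2 _ _ _); rewrite mulr_ge0 ?ge //.
Qed.

Definition growth (R : realType) (d : nat) (p q : R) (z : 'M[R]_d * 'M[R]_d) : R :=
  1 + frob z.1 `^ p + frob z.2 `^ q.

Lemma growth_ge1 (R : realType) (d : nat) (p q : R) (z : 'M[R]_d * 'M[R]_d) :
  1 <= growth p q z.
Proof. by rewrite /growth -addrA lerDl addr_ge0 // powR_ge0. Qed.

(** Together with [growth_distz0], this lets the quasi-triangle inequality carry the growth weight
    from one point to another. *)
Lemma distz0_growth (R : realType) (d : nat) (p q : R) (z : 'M[R]_d * 'M[R]_d) :
  1 <= p -> 1 <= q -> distz p q z 0 <= growth p q z.
Proof.
move=> p1 q1; rewrite /distz /growth !subr0 -addrA.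
apply: ler_wpDl => //; apply: lerD.
  by rewrite ler_pdivrMr ?ler_peMr ?powR_ge0 // ?(lt_le_trans _ p1).
by rewrite ler_pdivrMr ?ler_peMr ?powR_ge0 // (lt_le_trans _ q1).
Qed.

Lemma growth_distz0 (R : realType) (d : nat) (p q : R) (z : 'M[R]_d * 'M[R]_d) :
  1 <= p -> 1 <= q -> growth p q z <= 1 + (p + q) * distz p q z 0.
Proof.
move=> p1 q1; rewrite /distz /growth !subr0 -addrA lerD2l.
have p0 : 0 < p by apply: lt_le_trans p1.
have q0 : 0 < q by apply: lt_le_trans q1.
set a := frob z.1 `^ p; set b := frob z.2 `^ q.
have -> : (p + q) * (a / p + b / q) = a + b + (q * (a / p) + p * (b / q)).
  by field; rewrite !gt_eqF.
by rewrite lerDl addr_ge0 // mulr_ge0 ?divr_ge0 ?powR_ge0 // ltW.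
Qed.

(** Error budget of [distD_transfer]: [X] is the distance from [z] to [D], [T] the growth of [z],
    and [a], [b] are the lengths of the two projection steps. The excess [delta * X] takes one half
    of [e * T], the terms with [eta] the other half. *)
Lemma transfer_arith (R : realFieldType) (delta C G K e eta X T a b : R) :
  0 < delta -> 0 <= C -> 0 < eta -> 1 <= T -> delta * K <= e / 2 ->
  eta * (1 + delta + 2 * C * G * (2 + K)) <= e / 2 ->
  X <= K * T -> a <= X + eta -> b <= eta * (2 * G * (2 + K) * T) ->
  (1 + delta) * a + C * b <= X + e * T.
Proof.
move=> delta0 C0 eta0 T1 Kdelta etaL XK aX bT.
have T0 : 0 <= T by apply: le_trans T1.
have delta10 : 0 <= 1 + delta by rewrite addr_ge0 // ltW.
set L := _ + _ * _ * _ * _ in etaL.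
have s1 : (1 + delta) * a <= (1 + delta) * (X + eta) by rewrite ler_wpM2l.
have s2 : C * b <= C * (eta * (2 * G * (2 + K) * T)) by rewrite ler_wpM2l.
have s3 : delta * X <= e / 2 * T.
  apply: le_trans (_ : delta * (K * T) <= _).
    by rewrite ler_wpM2l // ltW.
  by rewrite mulrA ler_wpM2r.
have s4 : eta * L * T <= e / 2 * T by rewrite ler_wpM2r.
have s5 : (1 + delta) * eta <= (1 + delta) * eta * T.
  by rewrite ler_peMr // mulr_ge0 // ltW.
apply: le_trans (lerD s1 s2) _; rewrite -subr_ge0.
rewrite (_ : _ - _ = (e / 2 * T - delta * X) + (e / 2 * T - eta * L * T) +
  ((1 + delta) * eta * T - (1 + delta) * eta)); last by rewrite /L; field.
by apply: addr_ge0; [apply: addr_ge0|]; rewrite subr_ge0.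
Qed.

Section distance_to_data.
Variables (R : realType) (d : nat) (p q : R).
Hypotheses (p1 : 1 <= p) (q1 : 1 <= q).
Local Notation Z := ('M[R]_d * 'M[R]_d)%type.
Local Notation growth := (growth p q).
Implicit Types (z w : Z) (D E : set Z).

Lemma distD_le z w D : D w -> distD p q z D <= distz p q z w.
Proof.
move=> Dw; apply: ge_inf; last by exists w.
by exists 0 => _ [u _ <-]; apply: distz_ge0.
Qed.

Lemma distD_ge0 z D : D !=set0 -> 0 <= distD p q z D.
Proof.
move=> [w Dw]; apply: lb_le_inf; first by exists (distz p q z w), w.
by move=> _ [u _ <-]; apply: distz_ge0.
Qed.

Lemma distD_adherent z D (eta : R) : D !=set0 -> 0 < eta ->
  exists2 w, D w & distz p q z w < distD p q z D + eta.
Proof.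
move=> [w Dw] eta0.
have [|_ [u Du <-] lt] := @inf_adherent _ [set distz p q z w | w in D] _ eta0.
  split; first by exists (distz p q z w), w.
  by exists 0 => _ [u _ <-]; apply: distz_ge0.
by exists u.
Qed.

Lemma distD_self z D : D z -> distD p q z D = 0.
Proof.
move=> Dz; apply/eqP; rewrite eq_le distD_ge0 ?andbT; last by exists z.
apply: le_trans (distD_le _ Dz) _.
have f0 : frob (0 : 'M[R]_d) = 0.
  by rewrite /frob big1 ?sqrtr0 // => i _; rewrite big1 // => j _; rewrite mxE expr0n.
by rewrite /distz !subrr f0 !powR0 ?mul0r ?addr0 // gt_eqF // (lt_le_trans _ p1, lt_le_trans _ q1).
Qed.

(** Compare [growth w] with the distance from [w] to [0] and pass through [z]; the quasi-triangle
    inequality is taken with [delta = 1], hence the factor [2]. *)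
Lemma growth_distz : exists C : R, 0 <= C /\ forall z w,
  growth w <= C * (growth z + distz p q z w).
Proof.
have [C [C0 HC]] := distz_triangle d p1 q1 (@ltr01 R).
have pq0 : 0 <= p + q by rewrite addr_ge0 // (le_trans _ p1, le_trans _ q1).
exists (1 + (p + q) * (2 + C)); split.
  by rewrite addr_ge0 // mulr_ge0 // addr_ge0.
move=> z w; apply: le_trans (growth_distz0 _ p1 q1) _.
have g1 := growth_ge1 p q z; have dzw := distz_ge0 z w p1 q1.
have s0 : 1 <= growth z + distz p q z w by rewrite (le_trans g1) ?lerDl.
rewrite [leRHS]mulrDl mul1r lerD // -mulrA ler_wpM2l //.
apply: le_trans (HC w z 0) _; rewrite distzC.
have := distz0_growth z p1 q1 => gz.
rewrite [leRHS]mulrDl lerD //; first by rewrite ler_wpM2l ?lerDr ?(le_trans _ g1).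
by rewrite ler_wpM2l // (le_trans gz) ?lerDl.
Qed.

Lemma distD_growth_le D : D !=set0 ->
  exists C : R, 0 <= C /\ forall z, distD p q z D <= C * growth z.
Proof.
move=> [w Dw]; have [C [C0 HC]] := distz_triangle d p1 q1 (@ltr01 R).
have d0 := distz_ge0 0 w p1 q1.
exists (2 + C * distz p q 0 w); split; first by rewrite addr_ge0 // mulr_ge0.
move=> z; apply: le_trans (distD_le z Dw) (le_trans (HC z 0 w) _).
rewrite [leRHS]mulrDl lerD //; first by rewrite ler_wpM2l ?distz0_growth.
by rewrite ler_peMr ?mulr_ge0 ?growth_ge1.
Qed.

(* Project [z] almost optimally onto [w] in [D], then [w] onto [E]: the growth
   of [w] is controlled by that of [z], so the second error is small. *)
Lemma distD_transfer (K e : R) : 0 <= K -> 0 < e -> exists2 eta : R, 0 < eta &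
  forall D E, D !=set0 -> E !=set0 ->
    (forall z, distD p q z D <= K * growth z) ->
    (forall w, D w -> distD p q w E <= eta * growth w) ->
    forall z, distD p q z E <= distD p q z D + e * growth z.
Proof.
move=> K0 e0.
(* Chosen so that [delta * K <= e / 2]; the [+ 1] keeps the denominator positive when [K = 0]. *)
pose delta := e / (2 * (K + 1)).
have K10 : 0 < K + 1 by rewrite ltr_wpDl.
have delta0 : 0 < delta by rewrite divr_gt0 // mulr_gt0.
have [C [C0 HC]] := distz_triangle d p1 q1 delta0.
have [G [G0 HG]] := growth_distz.
pose L := 1 + delta + 2 * C * G * (2 + K).
have L0 : 0 < L.
  by rewrite ltr_wpDr ?mulr_ge0 ?addr_ge0 // addr_gt0.
(* The bound [1] serves to control the growth of [w], the bound [e / 2 / L] to meet the budget of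
   [transfer_arith]. Neither depends on [D] or [E]. *)
pose eta := Num.min 1 (e / 2 / L).
have eta0 : 0 < eta by rewrite lt_min ltr01 /= !divr_gt0.
have eta1 : eta <= 1 by rewrite ge_min lexx.
have etaL : eta * L <= e / 2.
  by rewrite -ler_pdivlMr // ge_min lexx orbT.
have Kdelta : delta * K <= e / 2.
  have -> : e / 2 = delta * (K + 1) by rewrite /delta; field; rewrite gt_eqF.
  by rewrite ler_wpM2l ?ltW // ltrDl.
exists eta => // D E D0 E0 HD HE z.
have g1 := growth_ge1 p q z; have g0 : 0 <= growth z by apply: le_trans g1.
have [w Dw zw] := distD_adherent z D0 eta0.
have [w' Ew' ww'] := distD_adherent w E0 eta0.
have gw : growth w <= G * (2 + K) * growth z.
  apply: le_trans (HG z w) _; rewrite -mulrA ler_wpM2l //.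
  have -> : (2 + K) * growth z = growth z + (K * growth z + growth z).
    by move: (growth z) => T; ring.
  rewrite lerD2l; apply: le_trans (ltW zw) _; apply: lerD; first exact: HD.
  exact: le_trans g1.
(* The factor [2] absorbs the slack [eta] of the second projection, as [eta <= eta * growth w]. *)
have dww' : distz p q w w' <= eta * (2 * G * (2 + K) * growth z).
  apply: le_trans (_ : eta * (2 * growth w) <= _).
    have gw1 := growth_ge1 p q w.
    have -> : eta * (2 * growth w) = eta * growth w + eta * growth w.
      by move: (growth w) => T; ring.
    apply: le_trans (ltW ww') _; apply: lerD; first exact: HE.
    by rewrite ler_peMr // ltW.
  by rewrite (ler_wpM2l (ltW eta0)) // -!mulrA ler_wpM2l // mulrA.
apply: le_trans (distD_le z Ew') (le_trans (HC z w w') _).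
exact: transfer_arith (HD z) (ltW zw) dww'.
Qed.

End distance_to_data.

(** * Uniform closeness and bounded data convergence *)

Section uniform_closeness.
Variables (R : realType) (d : nat) (p q : R).
Hypotheses (p1 : 1 <= p) (q1 : 1 <= q).
Local Notation Z := ('M[R]_d * 'M[R]_d)%type.
Local Notation growth := (growth p q).
Variables (Dn : nat -> set Z) (D : set Z).
Hypotheses (Dn0 : forall n, Dn n !=set0) (D0 : D !=set0).

Definition uniformly_close : Prop :=
  forall e : R, 0 < e -> exists N : nat, forall n, (N <= n)%N ->
    forall z : Z, inY z.1 -> inY z.2 ->
    `|distD p q z (Dn n) - distD p q z D| <= e * growth z.

(** Apply [distD_transfer] from [D] to [Dn n], then back. The way back needs a growth bound for the
    distance to [Dn n] that is uniform in [n]; the first transfer supplies it, with constant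
    [K + e]. *)
Lemma bounded_data_conv_close : bounded_data_conv p q Dn D -> uniformly_close.
Proof.
move=> [[a [a0 aD]] [b [b0 bD]]] e e0.
have [K [K0 HK]] := distD_growth_le p1 q1 D0.
have eK0 : 0 <= K + e by rewrite addr_ge0 // ltW.
have [eta1 eta10 H1] := distD_transfer d p1 q1 K0 e0.
have [eta2 eta20 H2] := distD_transfer d p1 q1 eK0 e0.
have /cvgrPdist_lt /(_ _ eta10) [N1 _ HN1] := a0.
have /cvgrPdist_lt /(_ _ eta20) [N2 _ HN2] := b0.
have small (c eta : R) (z : Z) : `|0 - c| < eta -> c * growth z <= eta * growth z.
  move=> lt; rewrite ler_wpM2r ?(le_trans ler01) ?growth_ge1 //.
  by rewrite ltW // (le_lt_trans _ lt) // sub0r normrN ler_norm.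
exists (maxn N1 N2) => n; rewrite geq_max => /andP[le1 le2] z _ _.
have up w : distD p q w (Dn n) <= distD p q w D + e * growth w.
  apply: H1 => // u Du.
  by apply: le_trans (aD n u Du) _; apply: small; apply: HN1.
have dn : distD p q z D <= distD p q z (Dn n) + e * growth z.
  apply: H2 => // [w|u Du].
    by rewrite mulrDl; apply: le_trans (up w) _; rewrite lerD2r.
  by apply: le_trans (bD n u Du) _; apply: small; apply: HN2.
by rewrite ler_norml lerBlDl up andbT lerBrDr addrC lerBlDr.
Qed.

(** The best constant is the supremum of [f n z / growth z] over [E n]. The growth bound on [f n]
    keeps this set bounded, without which [sup] would return a default value. *)
Lemma sup_ratio_cvg (E : nat -> set Z) (f : nat -> Z -> R) :
  (forall n, E n !=set0) -> (forall n z, 0 <= f n z) ->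
  (forall n, exists C : R, forall z, f n z <= C * growth z) ->
  (forall e : R, 0 < e -> exists N : nat, forall n, (N <= n)%N ->
     forall z, E n z -> f n z <= e * growth z) ->
  exists a : nat -> R, a @ \oo --> (0 : R) /\
    forall n z, E n z -> f n z <= a n * growth z.
Proof.
move=> E0 f0 fC fe.
have g0 z : 0 < growth z by rewrite (lt_le_trans ltr01) ?growth_ge1.
pose S n := [set f n z / growth z | z in E n].
have S0 n : S n !=set0 by have [z Ez] := E0 n; exists (f n z / growth z), z.
have Sle n z : E n z -> f n z / growth z <= sup (S n).
  move=> Ez; apply: ub_le_sup; last by exists z.
  by have [C HC] := fC n; exists C => _ [u _ <-]; rewrite ler_pdivrMr.
exists (fun n => sup (S n)); split; last first.
  by move=> n z Ez; rewrite -ler_pdivrMr // Sle.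
apply/cvgrPdist_le => e e0; have [N HN] := fe e e0.
exists N => // n /= Nn; rewrite sub0r normrN ger0_norm.
  by apply: ge_sup => // _ [z Ez <-]; rewrite ler_pdivrMr // HN.
have [z Ez] := E0 n.
by apply: le_trans (Sle n z Ez); rewrite divr_ge0 // ltW.
Qed.

(** On [D] the distance to [D] vanishes, so closeness bounds the distance to [Dn n] alone; on [Dn n]
    the roles are exchanged. *)
Lemma close_bounded_data_conv :
  (forall n, Dn n `<=` [set z | inY z.1 /\ inY z.2]) ->
  D `<=` [set z | inY z.1 /\ inY z.2] ->
  uniformly_close -> bounded_data_conv p q Dn D.
Proof.
move=> DnY DY close; split.
- apply: (sup_ratio_cvg (E := fun=> D) (f := fun n z => distD p q z (Dn n))) => //.
  + by move=> n z; apply: distD_ge0.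
  + by move=> n; have [C [_ HC]] := distD_growth_le p1 q1 (Dn0 n); exists C.
  + move=> e e0; have [N HN] := close e e0; exists N => n Nn z Dz.
    have [Y1 Y2] := DY z Dz; have := HN n Nn z Y1 Y2.
    by rewrite (distD_self p1 q1 Dz) subr0; apply: le_trans; apply: ler_norm.
- apply: (sup_ratio_cvg (E := Dn) (f := fun n z => distD p q z D)) => //.
  + by move=> n z; apply: distD_ge0.
  + by move=> n; have [C [_ HC]] := distD_growth_le p1 q1 D0; exists C.
  + move=> e e0; have [N HN] := close e e0; exists N => n Nn z Dz.
    have [Y1 Y2] := DnY n z Dz; have := HN n Nn z Y1 Y2.
    rewrite (distD_self p1 q1 Dz) sub0r normrN; apply: le_trans; exact: ler_norm.
Qed.

End uniform_closeness.

(** * Lebesgue measure on tuples *)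

Section measurability.
Context {d : measure_display} {T : measurableType d} {R : realType} {K : finType}.
Variables (E : set T) (g : K -> T -> R).
Hypotheses (mE : measurable E) (mg : forall k, measurable_fun E (g k)).

(* An open subset of [R ^ K] is a countable union of open cubes with rational
   centers. *)
Lemma measurable_preimage_open (U : set (K -> R)) :
  (forall u, U u -> exists2 e : R, 0 < e &
     forall v : K -> R, (forall k, `|v k - u k| < e) -> U v) ->
  measurable (E `&` [set x | U (g^~ x)]).
Proof.
move=> oU.
pose cube (c : {ffun K -> rat} * nat) :=
  [set v : K -> R | forall k, `|v k - ratr (c.1 k)| < c.2.+1%:R^-1].
(* A cube that sticks out of [U] contributes the empty set. *)
pose F (c : {ffun K -> rat} * nat) : set T :=
  [set x | cube c `<=` U /\ (E x /\ cube c (g^~ x))].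
rewrite (_ : _ `&` _ = \bigcup_c F c); last first.
  apply/seteqP; split => [x [Ex /= Ux]|x [c _ [cU [Ex cx]]]]; last first.
    by split => //; apply: cU.
  have [e e0 eU] := oU _ Ux.
  (* Points of the cube and [g^~ x] are then both within [e / 2] of the center in each
     coordinate. *)
  pose n := Num.truncn (2 / e).
  have ne : n.+1%:R^-1 < e / 2.
    rewrite -[ltRHS]invrK ltf_pV2 ?posrE ?invr_gt0 ?divr_gt0 // invf_div.
    exact: truncnS_gt.
  have rc k : exists c : rat, `|g k x - ratr c| < n.+1%:R^-1.
    have [c] := @rat_in_itvoo R (g k x - n.+1%:R^-1) (g k x + n.+1%:R^-1) ltac:(
      by rewrite ltrD2l gtrN // invr_gt0).
    by rewrite in_itv /= => lr; exists c; rewrite distrC ltr_distl.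
  pose c := [ffun k => xchoose (rc k)].
  have cx k : `|g k x - ratr (c k)| < n.+1%:R^-1.
    by rewrite ffunE; apply: (xchooseP (rc k)).
  exists (c, n) => //; split => [v cv|]; last by split.
  apply: eU => k; have := cx k; have := cv k; rewrite /= => h1 h2.
  rewrite (_ : v k - g k x = (v k - ratr (c k)) - (g k x - ratr (c k))); last by ring.
  apply: le_lt_trans (ler_normB _ _) _.
  by rewrite (splitr e) ltrD // (lt_trans _ ne).
apply: countable_bigcupT_measurable => //.
move=> c; have [cU|ncU] := pselect (cube c `<=` U); last first.
  by rewrite (_ : F c = set0) //; apply/seteqP; split => // x [].
rewrite (_ : F c = E `&` \bigcap_(k in setT)
  (E `&` g k @^-1` ball (ratr (c.1 k) : R) c.2.+1%:R^-1)); last first.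
  apply/seteqP; split => [x [_ [Ex cx]]|x [Ex cx]]; split => //.
    by move=> k _; split => //=; rewrite /ball /= distrC; apply: cx.
  by split => // k; have [_] := cx k I; rewrite /= /ball /= distrC.
apply: measurableI => //; apply: fin_bigcap_measurable => // k _.
by apply: mg => //; apply: measurable_realfun.measurable_ball.
Qed.

End measurability.

Section lebesgue_tuple.
Context {R : realType}.

(** Each coordinate has its own radius, since [small_subset_of_open] shrinks a single side. *)
Definition box n (c : n.-tuple R) (r : 'I_n -> R) : set (n.-tuple R) :=
  [set x | forall i, `|tnth x i - tnth c i| < r i].

Lemma measurable_box n (c : n.-tuple R) (r : 'I_n -> R) : measurable (box c r).
Proof.
rewrite (_ : box c r = \bigcap_(i in setT)
  ((fun x => tnth x i) @^-1` ball (tnth c i : R) (r i))); last first.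
  apply/seteqP; split => [x cx i _|x cx i]; first by rewrite /= /ball /= distrC; apply: cx.
  by have := cx i I; rewrite /= /ball /= distrC.
apply: fin_bigcap_measurable => // i _.
rewrite -[X in measurable X]setTI; apply: measurable_tnth => //.
exact: measurable_realfun.measurable_ball.
Qed.

Lemma measurable_tuple_open n (O : set (n.-tuple R)) : tuple_open O -> measurable O.
Proof.
move=> oO; rewrite (_ : O = setT `&` [set x | [set u | O [tuple u i | i < n]] (fun i => tnth x i)]).
  apply: measurable_preimage_open => // [k|u Ou]; first exact: measurable_tnth.
  have [e e0 He] := oO _ Ou; exists e => // v vu.
  by apply: He => i; rewrite !tnth_mktuple.
have tE x : [tuple tnth x i | i < n] = x :> n.-tuple R.
  by apply: eq_from_tnth => i; rewrite tnth_mktuple.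
by rewrite setTI; apply/seteqP; split => x /=; rewrite tE.
Qed.

Lemma measurable_tcons n : measurable_fun setT (@tcons R n).
Proof. exact: measurable_cons. Qed.

Lemma preimage_tcons_box n (c : n.+1.-tuple R) (r : 'I_n.+1 -> R) :
  @tcons R n @^-1` box c r = (ball (thead c : R) (r ord0)) `*`
    box (behead_tuple c) (fun i => r (lift ord0 i)).
Proof.
apply/seteqP; split => [[x y] /= cxy|[x y] /= [cx cy] i].
  split => [|i] /=; first by rewrite /ball /= distrC; have := cxy ord0; rewrite tnth0.
  by have := cxy (lift ord0 i); rewrite tnthS [c in tnth c (lift _ _)]tuple_eta tnthS.
case: (unliftP ord0 i) => [j|] ->.
  by have := cy j; rewrite tnthS [c in tnth c (lift _ _)]tuple_eta tnthS.
by rewrite tnth0 distrC.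
Qed.

Section tcons_measure.
Context {n : nat} (mu : {sigma_finite_measure set (n.-tuple R) -> \bar R}).
Hypothesis mu_box : forall c r, (mu (box c r) < +oo)%E.

(** The recursive clause of [lebesgue_tuple], with a genuine measure [mu] in place of the recursive
    call, so that it can be given a measure structure. *)
Definition tcons_measure := pushforward (lebesgue_measure \x mu)%E (@tcons R n).

Let tcons_measure0 : tcons_measure set0 = 0%E.
Proof. by rewrite /tcons_measure /pushforward preimage_set0 measure0. Qed.

Let tcons_measure_ge0 A : (0 <= tcons_measure A)%E.
Proof. exact: (measure_ge0 (lebesgue_measure \x mu)%E). Qed.

Let tcons_measure_sigma_additive : semi_sigma_additive tcons_measure.
Proof.
apply: (@measure_semi_sigma_additive _ _ _ (pushforward _ _)).
exact: measurable_tcons.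
Qed.

HB.instance Definition _ := isMeasure.Build _ _ _ tcons_measure
  tcons_measure0 tcons_measure_ge0 tcons_measure_sigma_additive.

Lemma tcons_measure_box c r : 0 <= r ord0 -> tcons_measure (box c r) =
  ((2 * r ord0)%:E * mu (box (behead_tuple c) (fun i => r (lift ord0 i))))%E.
Proof.
move=> r0; rewrite /tcons_measure /pushforward preimage_tcons_box.
rewrite product_measure1E //=; first by rewrite lebesgue_measure_ball // mulr_natl.
  exact: measurable_realfun.measurable_ball.
exact: measurable_box.
Qed.

Let tcons_measure_sigma_finite : sigma_finite setT tcons_measure.
Proof.
(* Cubes centered at the origin exhaust the space and have finite measure by [mu_box]. *)
exists (fun k => box [tuple 0 | _ < n.+1] (fun=> k%:R)).
  apply/esym/seteqP; split => // x _.
  pose M := \sum_i `|tnth x i|.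
  exists (Num.truncn M).+1 => //= i; rewrite tnth_mktuple subr0.
  apply: le_lt_trans (truncnS_gt _).
  by rewrite /M (bigD1 i) //= lerDl sumr_ge0.
move=> k; split; first exact: measurable_box.
by rewrite tcons_measure_box // lte_mul_pinfty ?lee_fin ?mulr_ge0.
Qed.

HB.instance Definition _ := Measure_isSigmaFinite.Build _ _ _ tcons_measure
  tcons_measure_sigma_finite.

Definition tcons_sigma_finite_measure :
  {sigma_finite_measure set (n.+1.-tuple R) -> \bar R} := tcons_measure.

End tcons_measure.

Lemma lebesgue_tuple_measure n :
  exists2 mu : {sigma_finite_measure set (n.-tuple R) -> \bar R},
    (mu : set (n.-tuple R) -> \bar R) = @lebesgue_tuple R n &
    forall c r, (forall i, 0 <= r i) -> mu (box c r) = (\prod_i (2 * r i))%:E.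
Proof.
elim: n => [|n [mu muE mubox]].
  exists [the {sigma_finite_measure set (0.-tuple R) -> \bar R} of
    dirac ([tuple] : 0.-tuple R)] => //.
  move=> c r r0; rewrite big_ord0 /= diracE mem_set // => -[] //.
(* The volume formula covers nonnegative radii; any other box lies in the one with radii cut off at
   [0]. *)
have mufin c r : (mu (box c r) < +oo)%E.
  have : (mu (box c r) <= mu (box c (fun i => (Num.max 0 (r i))%R)))%E.
    apply: le_measure; rewrite ?inE; [exact: measurable_box|exact: measurable_box|].
    by move=> x cx i; rewrite lt_max cx orbT.
  move=> /le_lt_trans -> //; rewrite mubox ?ltry // => i; by rewrite le_max lexx.
exists (tcons_sigma_finite_measure mufin).
  by rewrite /= -muE.
move=> c r r0; rewrite /= tcons_measure_box // mubox //.
by rewrite -EFinM big_ord_recl.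
Qed.

End lebesgue_tuple.

(** * Integrals of the distance *)

Lemma distz_small (R : realType) (d : nat) (p q s : R) :
  1 <= p -> 1 <= q -> 0 < s -> exists2 e : R, 0 < e &
  forall z w : 'M[R]_d * 'M[R]_d, (forall i j, `|(z.1 - w.1) i j| < e) ->
    (forall i j, `|(z.2 - w.2) i j| < e) -> distz p q z w <= s.
Proof.
move=> p1 q1 s0; pose t := Num.min 1 (s / 2).
have t0 : 0 < t by rewrite lt_min ltr01 divr_gt0.
have t1 : t <= 1 by rewrite ge_min lexx.
have ts : t <= s / 2 by rewrite ge_min lexx orbT.
(* Dividing by [d.+1] avoids a zero divisor and makes the Frobenius norm at most [t]; as [t <= 1],
   its power [r] is at most [t] too. *)
exists (t / d.+1%:R); first by rewrite divr_gt0.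
have comp (A : 'M[R]_d) (r : R) : 1 <= r ->
    (forall i j, `|A i j| < t / d.+1%:R) -> frob A `^ r / r <= s / 2.
  move=> r1 HA; have r0 : 0 < r by apply: lt_le_trans r1.
  have ft : frob A <= t.
    apply: le_trans (frob_entry_bound (ltW (divr_gt0 t0 (ltr0Sn R d))) _) _.
      by move=> i j; apply: ltW.
    by rewrite mulrCA ler_piMr ?ltW // ltr_pdivrMr ?ltr0Sn // mul1r ltr_nat.
  apply: le_trans (_ : frob A `^ r <= _).
    by rewrite ler_pdivrMr // ler_peMr ?powR_ge0.
  apply: le_trans (_ : t `^ r <= _).
    by rewrite ge0_ler_powR ?nnegrE ?frob_ge0 // ltW.
  by apply: le_trans ts; rewrite ge1r_powR // t0.
move=> z w zw1 zw2; rewrite /distz (splitr s) lerD //; exact: comp.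
Qed.

(* Unfolding the infimum makes [//] diverge. *)
Local Opaque distD distz.

(** An almost-nearest point [w] of [z] remains a competitor for [z'] near [z]. This half of
    continuity makes the sets where the distance is below [r] open, which is what measurability
    takes. *)
Lemma distD_usc (R : realType) (d : nat) (p q : R)
    (D : set ('M[R]_d * 'M[R]_d)) (z : 'M[R]_d * 'M[R]_d) (r : R) :
  1 <= p -> 1 <= q -> D !=set0 -> distD p q z D < r ->
  exists2 e : R, 0 < e & forall z' : 'M[R]_d * 'M[R]_d, (forall i j, `|z'.1 i j - z.1 i j| < e) ->
    (forall i j, `|z'.2 i j - z.2 i j| < e) -> distD p q z' D < r.
Proof.
move=> p1 q1 D0 zr; have eta0 : 0 < r - distD p q z D by rewrite subr_gt0.
have [w Dw] := distD_adherent p1 q1 z D0 eta0; rewrite addrC subrK => wr.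
have a0 := distz_ge0 z w p1 q1; set a := distz p q z w in wr a0.
(* The gap [r - a] is split: [delta * a] stays strictly below one half, the term with [C] within the
   other. *)
pose delta := (r - a) / (2 * (a + 1)).
have ra0 : 0 < r - a by rewrite subr_gt0.
have a10 : 0 < a + 1 by rewrite ltr_wpDl.
have delta0 : 0 < delta by rewrite divr_gt0 // mulr_gt0.
have [C [C0 HC]] := distz_triangle d p1 q1 delta0.
have C10 : 0 < C + 1 by rewrite ltr_wpDl.
have [|e e0 He] := @distz_small R d p q ((r - a) / (2 * (C + 1))) p1 q1.
  by rewrite divr_gt0 // mulr_gt0.
exists e; first exact: e0.
move=> z' h1 h2.
apply: le_lt_trans (distD_le p1 q1 z' Dw) _.
rewrite distzC; apply: le_lt_trans (HC w z z') _.
rewrite [distz p q w z]distzC -/a [distz p q z z']distzC.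
have dzz : distz p q z' z <= (r - a) / (2 * (C + 1)).
  by apply: He => i j; rewrite !mxE.
apply: le_lt_trans (_ : _ <= (1 + delta) * a + C * ((r - a) / (2 * (C + 1)))) _.
  by rewrite lerD2l ler_wpM2l.
have s1 : delta * a < (r - a) / 2.
  have -> : (r - a) / 2 = delta * (a + 1) by rewrite /delta; field; rewrite gt_eqF.
  by rewrite ltr_pM2l // ltrDl.
have s2 : C * ((r - a) / (2 * (C + 1))) <= (r - a) / 2.
  have -> : (r - a) / 2 = (C + 1) * ((r - a) / (2 * (C + 1))).
    by field; rewrite gt_eqF.
  by rewrite ler_wpM2r ?lerDl // divr_ge0 ?mulr_ge0 // ltW.
rewrite [ltRHS](_ : r = a + (r - a) / 2 + (r - a) / 2); last by field.
by rewrite mulrDl mul1r ltr_leD // ltrD2l.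
Qed.

Section integral_functionals.
Context {d : measure_display} {T : measurableType d} {R : realType} {n : nat}.
Variables (p q : R) (E : set T).
Hypotheses (p1 : 1 <= p) (q1 : 1 <= q) (mE : measurable E).
Local Notation Z := ('M[R]_n * 'M[R]_n)%type.
Local Notation growth := (growth p q).
Implicit Types (v : T -> Z) (A B D : set Z).

Definition mx_measurable (f : T -> 'M[R]_n) : Prop :=
  forall i j, measurable_fun E (fun x => f x i j).

Lemma measurable_powR_frob (r : R) (f : T -> 'M[R]_n) : mx_measurable f ->
  measurable_fun E (fun x => frob (f x) `^ r).
Proof.
move=> mf.
rewrite (_ : (fun _ => _) = (fun x => ((\sum_(i < n) \sum_(j < n) f x i j ^+ 2) `^ 2^-1) `^ r)).
  apply: (measurableT_comp (measurable_powR r)).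
  apply: (measurableT_comp (measurable_powR 2^-1)).
  apply: measurable_sum => i; apply: measurable_sum => j.
  exact: measurable_funX.
apply/funext => x; rewrite powR12_sqrt //.
by apply: sumr_ge0 => i _; apply: sumr_ge0 => j _; rewrite sqr_ge0.
Qed.

(** Rays unbounded below generate the Borel sets, and [distD_usc] turns their preimages into open
    conditions on the finitely many entries of [v x]. *)
Lemma measurable_distD D v : D !=set0 ->
  mx_measurable (fun x => (v x).1) -> mx_measurable (fun x => (v x).2) ->
  measurable_fun E (fun x => distD p q (v x) D).
Proof.
move=> D0 m1 m2; apply: (measurability _ (RGenInftyO.measurableE R)).
move=> _ [_ [r ->] <-].
(* The boolean selects the component, so a pair of matrices becomes a real function on a finite
   type. *)
pose mats (u : bool * ('I_n * 'I_n) -> R) : Z :=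
  (\matrix_(i, j) u (true, (i, j)), \matrix_(i, j) u (false, (i, j))).
pose g k x := let: (b, (i, j)) := k in (if b then (v x).1 else (v x).2) i j.
have matsE x : mats (g^~ x) = v x.
  by rewrite [RHS]surjective_pairing; congr pair; apply/matrixP => i j; rewrite mxE.
rewrite (_ : _ `&` _ = E `&` [set x | [set u | distD p q (mats u) D < r] (g^~ x)]).
  apply: measurable_preimage_open => // [[[] [i j]]|u /= ur]; [exact: m1|exact: m2|].
  have [e e0 He] := distD_usc p1 q1 D0 ur; exists e; first exact: e0.
  by move=> u' uu'; apply: He => i j; rewrite !mxE.
by apply/seteqP; split => x [Ex] /=; rewrite in_itv /= matsE.
Qed.

Lemma measurable_growth v :
  mx_measurable (fun x => (v x).1) -> mx_measurable (fun x => (v x).2) ->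
  measurable_fun E (fun x => growth (v x)).
Proof.
move=> m1 m2; apply: measurable_funD; last exact: measurable_powR_frob.
by apply: measurable_funD; last exact: measurable_powR_frob.
Qed.

Variable mu : {measure set T -> \bar R}.

Lemma integral_growth v :
  mx_measurable (fun x => (v x).1) -> mx_measurable (fun x => (v x).2) ->
  (\int[mu]_(x in E) (growth (v x))%:E = mu E +
    \int[mu]_(x in E) (frob (v x).1 `^ p)%:E +
    \int[mu]_(x in E) (frob (v x).2 `^ q)%:E)%E.
Proof.
move=> m1 m2.
under eq_integral do rewrite !EFinD.
rewrite !ge0_integralD //=.
- by rewrite integral_cst // mul1e.
- by move=> x _; rewrite lee_fin powR_ge0.
- by apply/measurable_EFinP; apply: measurable_powR_frob.
- by move=> x _; rewrite -EFinD lee_fin addr_ge0 ?powR_ge0.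
- apply/measurable_EFinP; apply: measurable_funD => //.
  exact: measurable_powR_frob.
- by move=> x _; rewrite lee_fin powR_ge0.
- by apply/measurable_EFinP; apply: measurable_powR_frob.
Qed.

Lemma le_integral_distD A B (e : R) v : 0 <= e -> A !=set0 -> B !=set0 ->
  mx_measurable (fun x => (v x).1) -> mx_measurable (fun x => (v x).2) ->
  (forall x, E x -> distD p q (v x) B <= distD p q (v x) A + e * growth (v x)) ->
  (\int[mu]_(x in E) (distD p q (v x) B)%:E <=
   \int[mu]_(x in E) (distD p q (v x) A)%:E +
   e%:E * \int[mu]_(x in E) (growth (v x))%:E)%E.
Proof.
move=> e0 A0 B0 m1 m2 le.
have gr0 x : (0 <= (growth (v x))%:E)%E.
  by rewrite lee_fin (le_trans ler01) ?growth_ge1.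
have mg : measurable_fun E (fun x => (growth (v x))%:E).
  by apply/measurable_EFinP; apply: measurable_growth.
have md D : D !=set0 -> measurable_fun E (fun x => (distD p q (v x) D)%:E).
  by move=> D0; apply/measurable_EFinP; apply: measurable_distD.
rewrite -ge0_integralZl // -ge0_integralD //.
- apply: ge0_le_integral => //.
  + by move=> x _; rewrite lee_fin distD_ge0.
  + exact: md.
  + by apply: emeasurable_funD; [exact: md|exact: measurable_funeM].
- by move=> x _; rewrite lee_fin distD_ge0.
- exact: md.
- by move=> x _; rewrite mule_ge0.
- exact: measurable_funeM.
Qed.

Lemma integral_distD_lty D v : D !=set0 ->
  mx_measurable (fun x => (v x).1) -> mx_measurable (fun x => (v x).2) ->
  (\int[mu]_(x in E) (growth (v x))%:E < +oo)%E ->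
  (\int[mu]_(x in E) (distD p q (v x) D)%:E < +oo)%E.
Proof.
move=> D0 m1 m2 fin; have [C [C0 HC]] := distD_growth_le p1 q1 D0.
have gr0 x : (0 <= (growth (v x))%:E)%E.
  by rewrite lee_fin (le_trans ler01) ?growth_ge1.
have mg : measurable_fun E (fun x => (growth (v x))%:E).
  by apply/measurable_EFinP; apply: measurable_growth.
apply: (@le_lt_trans _ _ (C%:E * \int[mu]_(x in E) (growth (v x))%:E)%E).
  rewrite -ge0_integralZl //; apply: ge0_le_integral => //.
  - by move=> x _; rewrite lee_fin distD_ge0.
  - by apply/measurable_EFinP; apply: measurable_distD.
  - exact: measurable_funeM.
  - by move=> x _; rewrite -EFinM lee_fin HC.
by rewrite lte_mul_pinfty // lee_fin.
Qed.

Lemma measurable_fun_two_valued d' (T' : measurableType d') (A : set T) (a b : T') :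
  measurable A -> measurable_fun E (fun x => if `[< A x >] then a else b).
Proof.
move=> mA; apply: (measurable_funS (E := setT)) => //.
rewrite -(setUv A); apply/measurable_funU => //; first exact: measurableC.
split.
  by apply: (eq_measurable_fun (cst a)) => [x /set_mem Ax|//]; rewrite asboolT.
by apply: (eq_measurable_fun (cst b)) => [x /set_mem nAx|//]; rewrite asboolF.
Qed.

Lemma integral_two_valued (A : set T) (a b : R) : measurable A -> A `<=` E ->
  0 <= a -> 0 <= b ->
  (\int[mu]_(x in E) (if `[< A x >] then a else b)%:E =
   a%:E * mu A + b%:E * mu (E `\` A))%E.
Proof.
move=> mA AE a0 b0; have mEA : measurable (E `\` A) by exact: measurableD.
have EU : E = A `|` (E `\` A) by rewrite setDUK.
rewrite [in LHS]EU ge0_integral_setU //.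
- rewrite (eq_integral (cst a%:E)) => [|x /set_mem Ax]; last by rewrite asboolT.
  rewrite [X in (_ + X)%E](eq_integral (cst b%:E)) => [|x /set_mem [_ nAx]];
    last by rewrite asboolF.
  by rewrite !integral_cst.
- rewrite -EU; apply/measurable_EFinP; exact: measurable_fun_two_valued.
- by move=> x _; case: ifP; rewrite lee_fin.
- by apply/disj_setPS => x [Ax [_]].
Qed.

End integral_functionals.

(** * The equivalence *)

Lemma abse_subr_le (R : realType) (a b : \bar R) (e : R) : (0 <= a)%E -> (0 <= b)%E ->
  (a < +oo)%E -> (b < +oo)%E -> (a <= b + e%:E)%E -> (b <= a + e%:E)%E ->
  (`|a - b| <= e%:E)%E.
Proof.
case: a b => [a||] [b||] //= _ _ _ _.
by rewrite -!EFinD !lee_fin => ab ba; rewrite ler_distl lerBlDr ba ab.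
Qed.

(** Start from a cube inside [Om], of volume [c], and shrink a single side by the factor [t]. In
    dimension [0] there is no side to shrink, hence the condition on [t]. *)
Lemma small_subset_of_open (R : realType) (n : nat) (Om : set (n.-tuple R))
    (mu : {measure set (n.-tuple R) -> \bar R}) :
  (forall c r, (forall i, 0 <= r i) -> mu (box c r) = (\prod_i (2 * r i))%:E) ->
  tuple_open Om -> Om !=set0 ->
  exists2 c : R, 0 < c & forall t : R, 1 <= t -> (n = 0%N -> t = 1) ->
    exists A : set (n.-tuple R), [/\ measurable A, A `<=` Om & mu A = (c / t)%:E].
Proof.
move=> mubox oOm [x Omx]; have [e e0 He] := oOm x Omx.
exists ((2 * e) ^+ n); first by rewrite exprn_gt0 // mulr_gt0.
move=> t t1 nt; have t0 : 0 < t by apply: lt_le_trans t1.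
pose r (i : 'I_n) := if val i == 0%N then e / t else e.
have re i : r i <= e.
  by rewrite /r; case: ifP => // _; rewrite ler_pdivrMr // ler_peMr // ltW.
exists (box x r); split; first exact: measurable_box.
  by move=> y yr; apply: He => i; apply: lt_le_trans (yr i) (re i).
rewrite mubox => [|i]; last by rewrite /r; case: ifP => _; rewrite ?divr_ge0 // ltW.
congr EFin; rewrite /r; case: n nt {oOm Omx He mubox re r x Om mu} => [|n] nt.
  by rewrite big_ord0 nt // divr1 expr0.
rewrite big_ord_recl /= prodr_const card_ord exprS; field.
by rewrite gt_eqF.
Qed.

(** Here [m] and [M] are the measures of the spike set and of [Om], [a] and [a'] the distances from
    [z] to [Dn n] and [D], and [b] and [0] those from [w0]. The second test, with [z = w0], gives
    [b * M <= e] after [m'] cancels, and this controls the contribution off the spike. *)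
Lemma two_spike_arith (R : realDomainType) (m m' M a b a' e : R) :
  0 < m -> m <= M -> 0 <= b ->
  `|a * m + b * (M - m) - (a' * m + 0 * (M - m))| <= e ->
  `|b * m' + b * (M - m') - (0 * m' + 0 * (M - m'))| <= e ->
  `|a - a'| * m <= e + e.
Proof.
move=> m0 mM b0 hz hw.
rewrite -[X in _ * X](gtr0_norm m0) -normrM.
have -> : (a - a') * m = (a * m + b * (M - m) - (a' * m + 0 * (M - m))) -
  b * (M - m) by ring.
apply: le_trans (ler_normB _ _) _; rewrite lerD //.
rewrite ger0_norm ?mulr_ge0 ?subr_ge0 //; apply: le_trans hw.
have -> : b * m' + b * (M - m') - (0 * m' + 0 * (M - m')) = b * M by ring.
have M0 : 0 <= M := le_trans (ltW m0) mM.
by rewrite ger0_norm ?mulr_ge0 // ler_wpM2l // gerBl ltW.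
Qed.

Section equivalence.
Variables (R : realType) (d : nat) (p q : R) (Om : set (d.-tuple R)).
Variables (Dn : nat -> set ('M[R]_d * 'M[R]_d)) (D : set ('M[R]_d * 'M[R]_d)).
Variable mu : {measure set (d.-tuple R) -> \bar R}.
Hypotheses (p1 : 1 <= p) (q1 : 1 <= q).
Hypothesis muE : (mu : set (d.-tuple R) -> \bar R) = @lebesgue_tuple R d.
Hypotheses (mOm : measurable Om) (Om_fin : (mu Om < +oo)%E).
Hypotheses (Dn0 : forall n, Dn n !=set0) (D0 : D !=set0).
Local Notation Z := ('M[R]_d * 'M[R]_d)%type.
Local Notation growth := (growth p q).
Local Notation J := (Jfun Om p q).
Implicit Types (v : d.-tuple R -> Z).

Lemma powint_ge0 (r : R) (f : d.-tuple R -> 'M[R]_d) : (0 <= powint Om r f)%E.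
Proof.
by rewrite /powint -muE integral_ge0 // => x _; rewrite lee_fin powR_ge0.
Qed.

Lemma Jfun_ge0 (A : set Z) v : A !=set0 -> (0 <= J A v)%E.
Proof.
by move=> A0; rewrite /Jfun -muE integral_ge0 // => x _; rewrite lee_fin distD_ge0.
Qed.

Lemma integral_growth_inV v : inV Om p q v ->
  (\int[mu]_(x in Om) (growth (v x))%:E =
   mu Om + powint Om p (fun x => (v x).1) + powint Om q (fun x => (v x).2))%E.
Proof. by move=> [[_ m1 _] [_ m2 _]]; rewrite integral_growth // /powint -muE. Qed.

Lemma Jfun_lty (A : set Z) v : A !=set0 -> inV Om p q v -> (J A v < +oo)%E.
Proof.
move=> A0 vV; have [[_ m1 f1] [_ m2 f2]] := vV.
rewrite /Jfun -muE; apply: integral_distD_lty => //.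
rewrite integral_growth_inV //.
exact: lte_add_pinfty (lte_add_pinfty Om_fin f1) f2.
Qed.

(** The bound is put on the power integrals rather than on the norm, so that both pointwise
    convergence and uniform convergence on bounded sets follow. *)
Lemma Jfun_cvg_on_bounded (K : R) : 0 <= K -> uniformly_close p q Dn D ->
  forall e : R, 0 < e -> exists N : nat, forall n, (N <= n)%N ->
    forall v, inV Om p q v ->
      (powint Om p (fun x => (v x).1) + powint Om q (fun x => (v x).2) <= K%:E)%E ->
      (`| J (Dn n) v - J D v | <= e%:E)%E.
Proof.
move=> K0 close e e0; pose m := fine (mu Om).
have m0 : 0 <= m by apply: fine_ge0.
have mE : mu Om = m%:E by rewrite /m fineK // ge0_fin_numE.
have mK0 : 0 < m + K + 1 by rewrite ltr_wpDl ?addr_ge0.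
(* The integral of the growth is at most [m + K]; the [+ 1] keeps the divisor positive. *)
have [eta eta0 eE] : exists2 eta, 0 < eta & e = eta * (m + K + 1).
  by exists (e / (m + K + 1)); rewrite ?divr_gt0 // mulfVK // gt_eqF.
have [N HN] := close _ eta0; exists N => n Nn v vV vK.
have [[Y1 m1 f1] [Y2 m2 f2]] := vV.
have gle : (eta%:E * \int[mu]_(x in Om) (growth (v x))%:E <= e%:E)%E.
  rewrite eE EFinM lee_pmul2l ?lte_fin //.
  rewrite (integral_growth_inV vV) mE -addeA; apply: le_trans (leeD2l _ vK) _.
  by rewrite -EFinD lee_fin lerDl.
apply: abse_subr_le; rewrite ?Jfun_ge0 ?Jfun_lty //.
- apply: le_trans (leeD2l _ gle); rewrite /Jfun -muE.
  apply: le_integral_distD => //; first exact: ltW.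
  move=> x Ox; have := HN n Nn (v x) (Y1 x Ox) (Y2 x Ox).
  by rewrite ler_distl => /andP[].
- apply: le_trans (leeD2l _ gle); rewrite /Jfun -muE.
  apply: le_integral_distD => //; first exact: ltW.
  move=> x Ox; have := HN n Nn (v x) (Y1 x Ox) (Y2 x Ox).
  by rewrite ler_distl => /andP[? _]; rewrite -lerBlDr.
Qed.

(** Take for [K] the sum of the two power integrals of [v] itself. *)
Lemma Jfun_cvg v : uniformly_close p q Dn D -> inV Om p q v ->
  (fun n => J (Dn n) v) @ \oo --> J D v.
Proof.
move=> close vV; have [[_ _ f1] [_ _ f2]] := vV.
pose P := (powint Om p (fun x => (v x).1) + powint Om q (fun x => (v x).2))%E.
have P0 : (0 <= P)%E by rewrite adde_ge0 ?powint_ge0.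
have PK : P = (fine P)%:E 
  by apply/esym/fineK; rewrite (ge0_fin_numE P0); exact: lte_add_pinfty f1 f2.
have fin (A : set Z) : A !=set0 -> J A v = (fine (J A v))%:E.
  move=> A0; apply/esym/fineK; rewrite ge0_fin_numE; first exact: Jfun_lty.
  exact: Jfun_ge0.
rewrite (fin D D0) (_ : (fun n => J (Dn n) v) = EFin \o (fun n => fine (J (Dn n) v))); last first.
  by apply/funext => n; rewrite /= -fin.
apply: cvg_EFin; first by apply: nearW.
apply/cvgrPdist_le => e e0.
have [N HN] := Jfun_cvg_on_bounded (fine_ge0 P0) close e0.
exists N => // n Nn /=; have := HN n Nn v vV.
rewrite -/P -PK => /(_ (lexx _)); rewrite (fin D D0) (fin (Dn n)) //.
by rewrite -EFinB abse_EFin lee_fin distrC.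
Qed.

(** Both summands of the norm are nonnegative, so each is at most [M], and the power integrals are
    bounded by the powers [p] and [q] of [M]. *)
Lemma Jfun_cvg_unif (B : set (d.-tuple R -> Z)) (M : R) :
  uniformly_close p q Dn D -> B `<=` inV Om p q ->
  (forall v, B v -> V_norm Om p q v <= M) ->
  forall e : R, 0 < e -> exists N : nat, forall n, (N <= n)%N ->
    forall v, B v -> (`| J (Dn n) v - J D v | <= e%:E)%E.
Proof.
move=> close BV BM e e0.
have K0 : 0 <= M `^ p + M `^ q by rewrite addr_ge0 ?powR_ge0.
have [N HN] := Jfun_cvg_on_bounded K0 close e0.
exists N => n Nn v Bv; have vV := BV v Bv; apply: HN => //.
have [[_ _ f1] [_ _ f2]] := vV; have := BM v Bv; rewrite /V_norm => vM.
have bound (r : R) f : 1 <= r -> (powint Om r f < +oo)%E -> Lr_norm Om r f <= M ->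
    (powint Om r f <= (M `^ r)%:E)%E.
  move=> r1 ff fM; have r0 : 0 < r by apply: lt_le_trans r1.
  have P0 := powint_ge0 r f.
  rewrite -(@fineK _ (powint Om r f)) ?ge0_fin_numE // lee_fin.
  rewrite -[leLHS](powRr1 (fine_ge0 P0)) -(mulVf (lt0r_neq0 r0)) powRrM.
  by rewrite ge0_ler_powR ?nnegrE ?powR_ge0 ?(le_trans _ fM) ?powR_ge0 // ltW.
rewrite EFinD; apply: leeD; apply: bound => //.
  by apply: le_trans vM; rewrite lerDl powR_ge0.
by apply: le_trans vM; rewrite lerDr powR_ge0.
Qed.

(** * Test functions with two values *)

Section two_valued_test_functions.
Variables (w0 : Z) (A : Z -> set (d.-tuple R)) (c : R).
Hypotheses (c0 : 0 < c) (Dw0 : D w0) (Yw0 : inY w0.1 /\ inY w0.2).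
Hypothesis mA : forall z, measurable (A z).
Hypothesis AOm : forall z, A z `<=` Om.
Hypothesis muA : forall z, mu (A z) = (c / growth z)%:E.

Definition spike (z : Z) : d.-tuple R -> Z :=
  fun x => if `[< A z x >] then z else w0.

Lemma spike_comp (S : Type) (f : Z -> S) z :
  (fun x => f (spike z x)) = fun x => if `[< A z x >] then f z else f w0.
Proof. by apply/funext => x; rewrite /spike; case: ifP. Qed.

Lemma integral_spike (f : Z -> R) z : (forall u, 0 <= f u) ->
  (\int[mu]_(x in Om) (f (spike z x))%:E =
   (f z * (c / growth z) + f w0 * (fine (mu Om) - c / growth z))%:E)%E.
Proof.
move=> f0.
have mE : mu (Om `\` A z) = (fine (mu Om) - c / growth z)%:E.
  have OmA : Om `&` A z = A z by apply/setIidr; apply: AOm.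
  by rewrite measureD // OmA -[X in (_ - X)%E]/(mu (A z)) muA EFinB fineK // ge0_fin_numE.
under eq_integral => x _ do rewrite (congr1 (@^~ x) (spike_comp f z)).
by rewrite integral_two_valued // muA mE.
Qed.

Lemma spike_inV z : inY z.1 -> inY z.2 -> inV Om p q (spike z).
Proof.
move=> Y1 Y2; have [Y3 Y4] := Yw0.
split; split => [x _|i j|].
- by rewrite /spike; case: ifP.
- rewrite (spike_comp (fun u : Z => u.1 i j)); exact: measurable_fun_two_valued.
- rewrite /powint -muE (integral_spike (f := fun u => frob u.1 `^ p)) ?ltry //.
  by move=> u; rewrite powR_ge0.
- by rewrite /spike; case: ifP.
- rewrite (spike_comp (fun u : Z => u.2 i j)); exact: measurable_fun_two_valued.
- rewrite /powint -muE (integral_spike (f := fun u => frob u.2 `^ q)) ?ltry //.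
  by move=> u; rewrite powR_ge0.
Qed.

(** Any [f] between [0] and the growth integrates to at most [growth z * (c / growth z) = c] on
    [A z], and to at most [growth w0] times the measure of [Om] elsewhere. *)
Lemma spike_V_norm : exists M : R, forall z, V_norm Om p q (spike z) <= M.
Proof.
pose K := c + growth w0 * fine (mu Om).
have g0 u : 0 < growth u by rewrite (lt_le_trans ltr01) ?growth_ge1.
have bound (r : R) (f : Z -> R) z : 1 <= r -> (forall u, 0 <= f u <= growth u) ->
    (fine (\int[mu]_(x in Om) (f (spike z x))%:E)) `^ r^-1 <= K `^ r^-1.
  move=> r1 f0; rewrite integral_spike /=; last by move=> u; have /andP[] := f0 u.
  have cg : 0 <= c / growth z by rewrite divr_ge0 // ltW.
  have cm : 0 <= fine (mu Om) - c / growth z.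
    rewrite subr_ge0 -lee_fin fineK ?ge0_fin_numE // -muA.
    by apply: le_measure; rewrite ?inE.
  have /andP[fz fz'] := f0 z; have /andP[fw fw'] := f0 w0.
  have le : f z * (c / growth z) + f w0 * (fine (mu Om) - c / growth z) <= K.
    apply: lerD.
      rewrite mulrCA; apply: ler_piMr; first exact: ltW.
      by rewrite ler_pdivrMr // mul1r.
    apply: ler_pM => //; by rewrite lerBlDr lerDl.
  have l0 : 0 <= f z * (c / growth z) + f w0 * (fine (mu Om) - c / growth z).
    by rewrite addr_ge0 // mulr_ge0.
  have K0 : 0 <= K := le_trans l0 le.
  apply: ge0_ler_powR; rewrite ?nnegrE //.
  by rewrite invr_ge0; apply: le_trans r1.
exists (K `^ p^-1 + K `^ q^-1) => z; rewrite /V_norm /Lr_norm /powint -muE.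
apply: lerD.
- apply: (bound p (fun u => frob u.1 `^ p)) => // u.
  by rewrite powR_ge0 /growth -addrA addrCA lerDl addr_ge0 // powR_ge0.
- apply: (bound q (fun u => frob u.2 `^ q)) => // u.
  by rewrite powR_ge0 /growth lerDr addr_ge0 // powR_ge0.
Qed.

Lemma Jfun_spike (B : set Z) z : B !=set0 -> J B (spike z) =
  (distD p q z B * (c / growth z) +
   distD p q w0 B * (fine (mu Om) - c / growth z))%:E.
Proof.
move=> B0; rewrite /Jfun -muE (integral_spike (f := fun u => distD p q u B)) //.
by move=> u; apply: distD_ge0.
Qed.

(** The spike at [z] compares the distances from [z], up to the contribution of [w0] outside [A z];
    the spike at [w0] is constant and bounds that contribution. *)
Lemma spike_uniformly_close :
  (forall e : R, 0 < e -> exists N : nat, forall n, (N <= n)%N ->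
    forall z, inY z.1 -> inY z.2 ->
      (`| J (Dn n) (spike z) - J D (spike z) | <= e%:E)%E) ->
  uniformly_close p q Dn D.
Proof.
move=> conv e e0.
(* Two errors [e * c / 2] add up to [e * c]; dividing by the measure [c / growth z] leaves
   [e * growth z]. *)
have [|N HN] := conv (e * c / 2); first by rewrite divr_gt0 // mulr_gt0.
exists N => n Nn z Y1 Y2; have g0 : 0 < growth z.
  by rewrite (lt_le_trans ltr01) ?growth_ge1.
have [Y3 Y4] := Yw0.
have := HN n Nn w0 Y3 Y4; have := HN n Nn z Y1 Y2.
rewrite !Jfun_spike // (distD_self p1 q1 Dw0) -!EFinB !abse_EFin !lee_fin.
have := distD_ge0 p1 q1 w0 (Dn0 n).
have cg : 0 < c / growth z by rewrite divr_gt0.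
have cm : c / growth z <= fine (mu Om).
  rewrite -lee_fin fineK ?ge0_fin_numE // -muA.
  by apply: le_measure; rewrite ?inE.
have -> : e * growth z = (e * c / 2 + e * c / 2) / (c / growth z).
  by field; rewrite !gt_eqF.
rewrite (ler_pdivlMr _ _ cg) => dw0 hz hw.
exact (two_spike_arith cg cm dw0 hz hw).
Qed.

End two_valued_test_functions.

End equivalence.

(** Meets the side condition of [small_subset_of_open]: matrices of size [0] have norm [0]. *)
Lemma growth_dim0 (R : realType) (d : nat) (p q : R) (z : 'M[R]_d * 'M[R]_d) :
  0 < p -> 0 < q -> d = 0%N -> growth p q z = 1.
Proof.
move=> p0 q0 d0; move: z; rewrite d0 => z.
by rewrite /growth /frob !big_ord0 sqrtr0 !powR0 ?gt_eqF // !addr0.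
Qed.

Theorem theorem4p2 (R : realType) (d : nat) (p : R) (Om : set (d.-tuple R))
    (Dn : nat -> set ('M[R]_d * 'M[R]_d)) (D : set ('M[R]_d * 'M[R]_d)) :
  1 < p ->
  tuple_open Om -> tuple_bounded Om -> Om !=set0 ->
  (forall n, [/\ closed (Dn n), Dn n !=set0 &
                 Dn n `<=` [set z | inY z.1 /\ inY z.2]]) ->
  closed D -> D !=set0 -> D `<=` [set z | inY z.1 /\ inY z.2] ->
  let q := p / (p - 1) in
  bounded_data_conv p q Dn D <->
  ((forall v, inV Om p q v ->
      (fun n => Jfun Om p q (Dn n) v) @ \oo --> Jfun Om p q D v) /\
   (forall B : set (d.-tuple R -> 'M[R]_d * 'M[R]_d),
      B `<=` inV Om p q ->
      (exists M : R, forall v, B v -> V_norm Om p q v <= M) ->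
      forall e : R, 0 < e -> exists N : nat, forall n, (N <= n)%N ->
        forall v, B v ->
          (`| Jfun Om p q (Dn n) v - Jfun Om p q D v | <= e%:E)%E)).
Proof.
move=> p1 oOm bOm Om0 DnP cD D0 DY q.
have {}p1' : 1 <= p := ltW p1.
have pm1 : 0 < p - 1 by rewrite subr_gt0.
have q1 : 1 <= q by rewrite /q ler_pdivlMr // mul1r gerBl.
have Dn0 n : Dn n !=set0 by have [] := DnP n.
have DnY n : Dn n `<=` [set z | inY z.1 /\ inY z.2] by have [] := DnP n.
have [mu muE mubox] := @lebesgue_tuple_measure R d.
have mOm : measurable Om := measurable_tuple_open oOm.
have Om_fin : (mu Om < +oo)%E.
  have [M OmM] := bOm.
  (* The [+ 1] makes the bound strict, and the absolute value keeps the radii nonnegative. *)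
  have sub : Om `<=` box [tuple 0 | _ < d] (fun=> `|M| + 1).
    move=> x Omx i; rewrite tnth_mktuple subr0.
    by apply: le_lt_trans (OmM x Omx i) _; rewrite ltr_pwDr // ler_norm.
  apply: (@le_lt_trans _ _ (mu (box [tuple 0 | _ < d] (fun=> `|M| + 1)))).
    by apply: le_measure; rewrite ?inE //; exact: measurable_box.
  by rewrite mubox ?ltry.
split.
  move=> /(bounded_data_conv_close p1' q1 Dn0 D0) close; split.
    move=> v; exact: (Jfun_cvg p1' q1 muE mOm Om_fin Dn0 D0 close).
  move=> B BV [M BM]; exact: (Jfun_cvg_unif p1' q1 muE mOm Om_fin Dn0 D0 close BV BM).
move=> [_ unif]; apply: close_bounded_data_conv => //.
have [w0 Dw0] := D0; have Yw0 := DY w0 Dw0.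
have [c c0 Hc] := small_subset_of_open (mu := mu) mubox oOm Om0.
have HA (z : 'M[R]_d * 'M[R]_d) : exists A : set (d.-tuple R),
    [/\ measurable A, A `<=` Om & mu A = (c / growth p q z)%:E].
  apply: Hc; first exact: growth_ge1.
  exact: growth_dim0 (lt_le_trans ltr01 p1') (lt_le_trans ltr01 q1).
have [A HAP] := choice HA.
have mA z : measurable (A z) by have [] := HAP z.
have AOm z : A z `<=` Om by have [] := HAP z.
have muA z : mu (A z) = (c / growth p q z)%:E by have [] := HAP z.
apply: (spike_uniformly_close p1' q1 muE mOm Om_fin Dn0 D0 c0 Dw0 Yw0 mA AOm muA).
move=> e e0.
have [M HM] := spike_V_norm p1' q1 muE mOm Om_fin w0 c0 mA AOm muA.
(* A bounded family in [V], although no bound is put on [z] itself. *)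
pose B := [set v | exists2 z, inY z.1 /\ inY z.2 & v = spike w0 A z].
have BV : B `<=` inV Om p q.
  move=> _ [z [Y1 Y2] ->].
  exact: (spike_inV muE mOm Om_fin Yw0 mA AOm muA Y1 Y2).
have BM : exists M : R, forall v, B v -> V_norm Om p q v <= M.
  by exists M => _ [z _ ->]; apply: HM.
have [N HN] := unif B BV BM e e0.
by exists N => n Nn z Y1 Y2; apply: HN => //; exists z.
Qed.
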